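(* Let $S\subseteq\mathbb{R}$ and $s\in S$. Then $s\in\mathrm{int}(S)$ if and only if $\mu(s)\subseteq{}^*S$. Consequently, the following are equivalent: (a) $S$ is open. (b) For all $s\in S$, $\mu(s)\subseteq{}^*S$. (c) $\mu(S)\subseteq{}^*S$.
   Context: $\mathbb{R}_+$ is the set of positive real numbers and $\mathbb{N}=\{1,2,3,\dots\}$. Fix an ultrafilter $\mathcal{U}$ on $\mathbb{R}_+$ such that $(0,\tfrac1n)\in\mathcal{U}$ for all $n\in\mathbb{N}$. A property of $\varepsilon\in\mathbb{R}_+$ holds almost everywhere (a.e.) if the set of $\varepsilon$ for which it holds belongs to $\mathcal{U}$. For nets $(a_\varepsilon),(b_\varepsilon)\in\mathbb{C}^{\mathbb{R}_+}$ write $(a_\varepsilon)\sim(b_\varepsilon)$ if $a_\varepsilon=b_\varepsilon$ a.e.; $\langle a_\varepsilon\rangle$ is the equivalence class, and ${}^*\mathbb{C}=\mathbb{C}^{\mathbb{R}_+}/\!\sim$ with operations induced pointwise; $\mathbb{C}$ is embedded via constant nets. For $S\subseteq\mathbb{C}$, ${}^*S=\{\langle s_\varepsilon\rangle : s_\varepsilon\in S\text{ a.e.}\}$; in particular this defines ${}^*\mathbb{R}$, ordered by $\langle a_\varepsilon\rangle<\langle b_\varepsilon\rangle$ iff $a_\varepsilon<b_\varepsilon$ a.e. $\mathcal{I}({}^*\mathbb{R})=\{x\in{}^*\mathbb{R}: |x|<\tfrac1n\text{ for all }n\in\mathbb{N}\}$ is the set of infinitesimals. For $s\in\mathbb{R}$,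 the monad at $s$ is $\mu(s)=\{s+dx: dx\in\mathcal{I}({}^*\mathbb{R})\}$; for $S\subseteq\mathbb{R}$, $\mu(S)=\{s+dx: s\in S,\ dx\in\mathcal{I}({}^*\mathbb{R})\}$. $\mathrm{int}(S)$ is the set of interior points of $S$ in the usual topology of $\mathbb{R}$, and open refers to this topology. *)

(* Defs.v *)
From HB Require Import structures.
From mathcomp Require Import all_boot all_order all_algebra.
From mathcomp Require Import complex.
From mathcomp Require Import all_classical all_reals all_analysis.
From mathcomp Require Import generic_quotient.

Set Implicit Arguments.
Unset Strict Implicit.
Unset Printing Implicit Defensive.

Import Order.TTheory GRing.Theory Num.Theory.
Import numFieldNormedType.Exports.

Local Open Scope classical_set_scope.
Local Open Scope ring_scope.
Local Open Scope quotient_scope.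

Notation net R := ({posnum R} -> R[i]).

Definition ae_eq_net (R : realType) (U : set_system {posnum R})
    (a b : net R) : bool :=
  `[< \forall e \near U, a e = b e >].

Lemma ae_eq_net_refl (R : realType) (U : set_system {posnum R})
  (FU : UltraFilter U) : reflexive (ae_eq_net U).
Proof. by move=> a; apply/asboolP; exact: nearW. Qed.

Lemma ae_eq_net_sym (R : realType) (U : set_system {posnum R})
  (FU : UltraFilter U) : symmetric (ae_eq_net U).
Proof.
by move=> a b; apply/idP/idP => /asboolP ab; apply/asboolP;
  apply: filterS ab => e ->.
Qed.

Lemma ae_eq_net_trans (R : realType) (U : set_system {posnum R})
  (FU : UltraFilter U) : transitive (ae_eq_net U).
Proof.
move=> b a c /asboolP ab /asboolP bc; apply/asboolP.
by apply: filterS2 ab bc => e -> ->.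
Qed.

Canonical ae_eq_net_equiv (R : realType) (U : set_system {posnum R})
    (FU : UltraFilter U) :=
  EquivRel (ae_eq_net U) (ae_eq_net_refl FU) (ae_eq_net_sym FU)
    (ae_eq_net_trans FU).

(* [starC FU] is the ultrapower *C; it is presented over the proof [FU] because
   the quotient needs [U] to be a filter. *)
Definition starC (R : realType) (U : set_system {posnum R})
  (FU : UltraFilter U) := {eq_quot (ae_eq_net_equiv FU)}.

HB.instance Definition _ (R : realType) (U : set_system {posnum R})
  (FU : UltraFilter U) := Choice.on (starC FU).
HB.instance Definition _ (R : realType) (U : set_system {posnum R})
  (FU : UltraFilter U) := EqQuotient.on (starC FU).

Section StarC.
Context (R : realType) (U : set_system {posnum R}) (FU : UltraFilter U).

Definition cls (a : net R) : starC FU := \pi_(starC FU) a.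

Lemma clsP (a b : net R) :
  cls a = cls b <-> \forall e \near U, a e = b e.
Proof.
split=> [/eqP|ab]; first by rewrite piE => /asboolP.
by apply/eqP; rewrite piE; apply/asboolP.
Qed.

Lemma cls_reprK (x : starC FU) : cls (repr x) = x.
Proof. exact: reprK. Qed.

Definition starC_const (z : R[i]) : starC FU := cls (fun=> z).

Definition starC_add (x y : starC FU) := cls (fun e => repr x e + repr y e).
Definition starC_opp (x : starC FU) := cls (fun e => - repr x e).
Definition starC_mul (x y : starC FU) := cls (fun e => repr x e * repr y e).
Definition starC_norm (x : starC FU) := cls (fun e => `|repr x e|).

Lemma repr_cls (a : net R) : \forall e \near U, repr (cls a) e = a e.
Proof. by apply/clsP; rewrite cls_reprK. Qed.

Lemma starC_addE (a b : net R) :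
  starC_add (cls a) (cls b) = cls (fun e => a e + b e).
Proof.
by apply/clsP; apply: filterS2 (repr_cls a) (repr_cls b) =>
  e -> ->.
Qed.

Lemma starC_oppE (a : net R) : starC_opp (cls a) = cls (fun e => - a e).
Proof. by apply/clsP; apply: filterS (repr_cls a) => e ->. Qed.

Lemma starC_mulE (a b : net R) :
  starC_mul (cls a) (cls b) = cls (fun e => a e * b e).
Proof.
by apply/clsP; apply: filterS2 (repr_cls a) (repr_cls b) =>
  e -> ->.
Qed.

Lemma starC_normE (a : net R) : starC_norm (cls a) = cls (fun e => `|a e|).
Proof. by apply/clsP; apply: filterS (repr_cls a) => e ->. Qed.

Lemma starC_addA : associative starC_add.
Proof.
move=> x y z; rewrite -[x]cls_reprK -[y]cls_reprK
  -[z]cls_reprK !starC_addE.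
by congr cls; apply/funext => e; rewrite addrA.
Qed.

Lemma starC_addC : commutative starC_add.
Proof.
by move=> x y; congr cls; apply/funext => e; rewrite addrC.
Qed.

Lemma starC_add0 : left_id (starC_const 0) starC_add.
Proof.
move=> x; rewrite -[x]cls_reprK starC_addE.
by congr cls; apply/funext => e; rewrite add0r.
Qed.

Lemma starC_addN : left_inverse (starC_const 0) starC_opp starC_add.
Proof.
move=> x; rewrite -[x]cls_reprK starC_oppE starC_addE.
by congr cls; apply/funext => e; rewrite addNr.
Qed.

HB.instance Definition _ := GRing.isZmodule.Build (starC FU)
  starC_addA starC_addC starC_add0 starC_addN.

Lemma starC_mulA : associative starC_mul.
Proof.
move=> x y z; rewrite -[x]cls_reprK -[y]cls_reprK
  -[z]cls_reprK !starC_mulE.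
by congr cls; apply/funext => e; rewrite mulrA.
Qed.

Lemma starC_mulC : commutative starC_mul.
Proof.
by move=> x y; congr cls; apply/funext => e; rewrite mulrC.
Qed.

Lemma starC_mul1 : left_id (starC_const 1) starC_mul.
Proof.
move=> x; rewrite -[x]cls_reprK starC_mulE.
by congr cls; apply/funext => e; rewrite mul1r.
Qed.

Lemma starC_mulDl : left_distributive starC_mul starC_add.
Proof.
move=> x y z; rewrite -[x]cls_reprK -[y]cls_reprK
  -[z]cls_reprK !(starC_mulE, starC_addE).
by congr cls; apply/funext => e; rewrite mulrDl.
Qed.

Lemma starC_oner_neq0 : starC_const 1 != 0 :> starC FU.
Proof.
apply/eqP => /clsP /filter_ex[e /eqP].
by rewrite oner_eq0.
Qed.

HB.instance Definition _ := GRing.Zmodule_isComNzRing.Build (starC FU)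
  starC_mulA starC_mulC starC_mul1 starC_mulDl starC_oner_neq0.

Definition star (S : set R[i]) : set (starC FU) :=
  [set x | exists2 a : net R, (\forall e \near U, S (a e)) & x = cls a].

(* A set of reals is transferred through the embedding of R into R[i]. *)
Definition starR (S : set R) : set (starC FU) := star (real_complex R @` S).

(* The order of *R; it relates only elements of *R = [starR setT]. *)
Definition starR_lt (x y : starC FU) : Prop :=
  exists a b : {posnum R} -> R,
    [/\ x = cls (fun e => real_complex R (a e)),
        y = cls (fun e => real_complex R (b e))
      & \forall e \near U, a e < b e].

Definition infinitesimal : set (starC FU) :=
  [set x | starR setT x /\ forall n : nat, (0 < n)%N ->
     starR_lt (starC_norm x) (starC_const (real_complex R n%:R^-1))].

Definition monad (s : R) : set (starC FU) :=
  [set starC_const (real_complex R s) + dx | dx in infinitesimal].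

Definition monad_set (S : set R) : set (starC FU) :=
  [set starC_const (real_complex R s) + dx | s in S & dx in infinitesimal].

End StarC.

Arguments cls {R U} FU a.
Arguments starC_const {R U} FU z.
Arguments star {R U} FU S.
Arguments starR {R U} FU S.
Arguments infinitesimal {R U} FU.
Arguments monad {R U} FU s.
Arguments monad_set {R U} FU S.

(* Main.v *)
(* For s interior, shifting s by an infinitesimal stays a.e. inside a small ball
   contained in S.  For s not interior, choose for each e a point t_e outside S
   at distance less than e from s; since (0, 1/n) belongs to U for all n, the
   net (t_e) represents an element of the monad at s, which avoids *S. *)
Require Import Defs.
From mathcomp Require Import all_boot all_order all_algebra.
From mathcomp Require Import complex.
From mathcomp Require Import all_classical all_reals all_analysis.
Import Order.TTheory GRing.Theory Num.Theory.
Import numFieldNormedType.Exports.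
Local Open Scope classical_set_scope.
Local Open Scope ring_scope.

Section RealNets.
Context (R : realType) (U : set_system {posnum R}) (FU : UltraFilter U).

(** Real-valued representatives let the order, norm and infinitesimality of *R be read off in R. *)
Definition clsR (r : {posnum R} -> R) : starC FU :=
  cls FU (fun e => real_complex R (r e)).

Lemma clsR_inj (a b : {posnum R} -> R) :
  clsR a = clsR b -> \forall e \near U, a e = b e.
Proof. by move=> /clsP; apply: filterS => e /complexI. Qed.

Lemma starC_const_addR (s : R) (r : {posnum R} -> R) :
  starC_const FU (real_complex R s) + clsR r = clsR (fun e => s + r e).
Proof.
transitivity (cls FU (fun e => real_complex R s + real_complex R (r e))).
  exact: starC_addE.
by congr cls; apply/funext => e; rewrite rmorphD.
Qed.

Lemma starC_normR (r : {posnum R} -> R) :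
  starC_norm (clsR r) = clsR (fun e => `|r e|).
Proof.
rewrite starC_normE; congr cls; apply/funext => e.
by rewrite normc_def /= expr0n addr0 sqrtr_sqr.
Qed.

(** Two representatives agree a.e. and the embedding of R is injective, so membership does not
    depend on the representative. *)
Lemma starR_clsR (A : set R) (r : {posnum R} -> R) :
  starR FU A (clsR r) <-> \forall e \near U, A (r e).
Proof.
split=> [[a Aa /clsP ra]|Ar].
  by apply: filterS2 Aa ra => e [y Ay <-] /complexI ->.
by exists (fun e => real_complex R (r e)) => //; apply: filterS Ar => e; exists (r e).
Qed.

Lemma starR_ex (A : set R) (x : starC FU) :
  starR FU A x -> exists r, x = clsR r.
Proof.
(* The net [a] is real only a.e.; where it is not, the value of [Re] is irrelevant to the class. *)
move=> [a Aa ->]; exists (fun e => complex.Re (a e)).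
by apply/clsP; apply: filterS Aa => e [y _ <-].
Qed.

Lemma starR_lt_clsR (a b : {posnum R} -> R) :
  starR_lt (clsR a) (clsR b) <-> \forall e \near U, a e < b e.
Proof.
split=> [[a' [b' [/clsR_inj aa' /clsR_inj bb' ab]]]|ab]; last by exists a, b.
by apply: filterS3 aa' bb' ab => e -> ->.
Qed.

Lemma infinitesimal_clsR (r : {posnum R} -> R) :
  infinitesimal FU (clsR r) <->
  forall n : nat, (0 < n)%N -> \forall e \near U, `|r e| < n%:R^-1.
Proof.
split=> [[_ rn] n n0|rn].
  by have := rn n n0; rewrite starC_normR => /starR_lt_clsR.
split=> [|n n0]; first by apply/starR_clsR; exact: nearW.
by rewrite starC_normR; apply/starR_lt_clsR; exact: rn.
Qed.

Lemma interior_monad (S : set R) (s : R) :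
  interior S s -> monad FU s `<=` starR FU S.
Proof.
move=> /nbhs_ballP[d /= d0 dS] _ [dx dx_inf <-].
have [r dxE] := starR_ex _ _ (proj1 dx_inf).
move: dx_inf; rewrite dxE starC_const_addR => /infinitesimal_clsR rn.
apply/starR_clsR.
have [n nd] : exists n : nat, n.+1%:R^-1 < d.
  (* The successor of the integer part of 1/d exceeds 1/d. *)
  by exists (Num.truncn d^-1); rewrite invf_plt ?posrE// truncnS_gt.
apply: filterS (rn n.+1 isT) => e re; apply: dS.
by rewrite -ball_normE /= opprD addrA subrr add0r normrN (lt_trans re).
Qed.

Lemma monad_interior (S : set R) (s : R)
    (U0 : forall n : nat, (0 < n)%N ->
      U [set e : {posnum R} | e%:num < n%:R^-1]) :
  monad FU s `<=` starR FU S -> interior S s.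
Proof.
move=> sS; apply: contrapT => nSs.
(* Here [t e] is the displacement from [s], not the point itself. Had some [e] no such displacement,
   the ball of radius [e] about [s] would lie in [S]. *)
have /choice[t tP] (e : {posnum R}) : exists t, `|t| < e%:num /\ ~ S (s + t).
  apply: contrapT => /forallNP et; apply: nSs.
  apply/nbhs_ballP; exists e%:num => //= y.
  rewrite -ball_normE /= distrC => ys; apply: contrapT => nSy.
  by apply: (et (y - s)); rewrite (addrC s) subrK.
have : starR FU S (starC_const FU (real_complex R s) + clsR t).
  apply: sS; exists (clsR t) => //; apply/infinitesimal_clsR => n n0.
  (* On the set (0, 1/n) of [U], |t_e| < e < 1/n. *)
  by apply: filterS (U0 n n0) => e /=; apply: lt_trans; exact: (tP e).1.
(* Members of [U] are nonempty, so some single [e] has [s + t e] in [S], against the choice of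
   [t]. *)
rewrite starC_const_addR => /starR_clsR/filter_ex[e].
exact: (tP e).2.
Qed.

End RealNets.

Theorem theorem3p2p1 (R : realType) (U : set_system {posnum R})
  (FU : UltraFilter U)
  (U0 : forall n : nat, (0 < n)%N -> U [set e : {posnum R} | e%:num < n%:R^-1])
  (S : set R) :
  (forall s : R, S s -> (interior S s <-> monad FU s `<=` starR FU S)) /\
  ((open S <-> (forall s : R, S s -> monad FU s `<=` starR FU S)) /\
   ((forall s : R, S s -> monad FU s `<=` starR FU S) <->
    monad_set FU S `<=` starR FU S)).
Proof.
have intP s : interior S s <-> monad FU s `<=` starR FU S.
  by split; [exact: interior_monad|exact: monad_interior].
split=> [s _|]; first exact: intP.
split; split.
- by rewrite openE => oS s /oS /intP.
- by move=> mS; rewrite openE => s /mS /intP.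
- by move=> mS _ [s Ss [dx dx_inf <-]]; apply: (mS s Ss); exists dx.
- by move=> mS s Ss _ [dx dx_inf <-]; apply: mS; exists s => //; exists dx.
Qed.
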